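(* Let $(\mathsf{U},\oplus)$, $\preceq_{\mathrm{p}}$, $\preceq$, $\mathsf{K}$, $\mathbf{0}$, $\mathbf{1}$ be as in the context, and let $\mathsf{L}\colon \mathsf{K}^2\times[0,1]^2\to\mathsf{K}$. Assume that $\oplus$ satisfies the cancellation law. (i) The $\mathcal{C}_{\preceq}$-operator with $n=2$ is well defined if and only if, for any $\mathbf{x}\in\mathsf{K}$, the function $[0,1]\ni c\mapsto \mathsf{L}(\mathbf{x},\mathbf{0},1,c)\oplus \mathsf{L}(\mathbf{x},\mathbf{x},c,0)$ is constant. (ii) The $\mathcal{C}_{\preceq}$-operator with $n=3$ is well defined if and only if, for any $b\in[0,1]$, any $\mathbf{x}\in\mathsf{K}$ and any $\mathbf{x}_1,\mathbf{x}_2\in\mathsf{K}$ with $\mathbf{x}_2\preceq\mathbf{x}_1$, both functions $[b,1]\ni c\mapsto \mathsf{L}(\mathbf{x},\mathbf{0},1,c)\oplus \mathsf{L}(\mathbf{x},\mathbf{x},c,b)$ and $[0,b]\ni c\mapsto \mathsf{L}(\mathbf{x}_1,\mathbf{x}_2,b,c)\oplus \mathsf{L}(\mathbf{x}_1,\mathbf{x}_1,c,0)$ are constant. (iii) For $n\ge 4$, the $\mathcal{C}_{\preceq}$-operator is well defined if and only if, for any $\mathbf{x}_1,\mathbf{x}_2\in\mathsf{K}$ with $\mathbf{x}_2\preceq\mathbf{x}_1$ and any $b_1,b_2\in[0,1]$ with $b_2\le b_1$, the function $[b_2,b_1]\ni c\mapsto \mathsf{L}(\mathbf{x}_1,\mathbf{x}_2,b_1,c)\oplus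 \mathsf{L}(\mathbf{x}_1,\mathbf{x}_1,c,b_2)$ is constant.
   Context: Setting: $\mathsf{U}$ is a non-empty set with a partial order $\preceq_{\mathrm{p}}$ and a commutative associative binary operation $\oplus\colon\mathsf{U}\times\mathsf{U}\to\mathsf{U}$ (called addition). A total order $\preceq$ on $\mathsf{U}$ is an admissible order w.r.t. $\preceq_{\mathrm{p}}$ if $\mathbf{x}\preceq_{\mathrm{p}}\mathbf{z}$ implies $\mathbf{x}\preceq\mathbf{z}$; $\preceq$ is such an order, and $\mathbf{x}\prec\mathbf{z}$ means $\mathbf{x}\preceq\mathbf{z}$ and $\mathbf{x}\ne\mathbf{z}$. $\mathsf{K}\subseteq\mathsf{U}$ is a non-empty set having a least element $\mathbf{0}$ and a greatest element $\mathbf{1}$ w.r.t. $\preceq_{\mathrm{p}}$ (both in $\mathsf{K}$), with $\mathbf{0}\preceq_{\mathrm{p}}\mathbf{1}$ and $\mathbf{0}\ne\mathbf{1}$. Cancellation law for $\oplus$: $\mathbf{x}_1\oplus\mathbf{v}=\mathbf{x}_2\oplus\mathbf{v}$ implies $\mathbf{x}_1=\mathbf{x}_2$ for all $\mathbf{x}_1,\mathbf{x}_2,\mathbf{v}\in\mathsf{U}$. $[n]=\{1,\dots,n\}$. $\mathbf{M}$ is the set of capacities on $[n]$: $\mu\colon 2^{[n]}\to[0,1]$ with $\mu(C)\le\mu(D)$ for $C\subset D$, $\mu(\varnothing)=0$, $\mu([n])=1$. For $\mathbf{X}=(\mathbf{x}_1,\dots,\mathbf{x}_n)\in\mathsf{K}^n$,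 $\Pi_{\mathbf{X}}$ is the set of permutations $\sigma$ of $[n]$ with $\mathbf{x}_{\sigma(1)}\preceq\dots\preceq\mathbf{x}_{\sigma(n)}$. The $\mathcal{C}_{\preceq}$-operator is $\mathcal{C}_{\preceq,\sigma,\mathsf{L}}(\mathbf{X},\mu)=\bigoplus_{i=1}^n \mathsf{L}(\mathbf{x}_{\sigma(i)},\mathbf{x}_{\sigma(i-1)},\mu(B_{\sigma(i)}),\mu(B_{\sigma(i+1)}))$ for $\sigma\in\Pi_{\mathbf{X}}$, with $\mathbf{x}_{\sigma(0)}=\mathbf{0}$, $B_{\sigma(i)}=\{\sigma(i),\dots,\sigma(n)\}$ for $i\in[n]$, $B_{\sigma(n+1)}=\varnothing$. It is well defined if, for every $\mathbf{X}\in\mathsf{K}^n$ and $\mu\in\mathbf{M}$, the value is the same for all $\sigma\in\Pi_{\mathbf{X}}$. *)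

(* Defs.v *)
From mathcomp Require Import all_boot all_order all_algebra all_fingroup.
From mathcomp Require Import classical_sets reals.

Set Implicit Arguments.
Unset Strict Implicit.
Unset Printing Implicit Defensive.

Import Order.TTheory GRing.Theory Num.Theory.
Local Open Scope ring_scope.

(* The partial order of [U] is its canonical order [(x <= y)%O]; the admissible
   total order is a separate relation [le] on the same type. *)
Definition admissible_order (d : Order.disp_t) (U : porderType d)
    (le : rel U) : Prop :=
  [/\ antisymmetric le, transitive le, total le &
      forall x z : U, (x <= z)%O -> le x z].

Definition cancellation_law (U : Type) (oplus : U -> U -> U) : Prop :=
  forall x1 x2 v : U, oplus x1 v = oplus x2 v -> x1 = x2.

Definition constant_on (R : numDomainType) (U : Type) (D : interval R)
    (f : R -> U) : Prop :=
  {in D &, forall c c' : R, f c = f c'}.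

Definition capacity (R : realType) (n : nat) (mu : {set 'I_n} -> R) : Prop :=
  [/\ forall C, mu C \in `[0, 1],
      forall C D : {set 'I_n}, C \subset D -> mu C <= mu D,
      mu finset.set0 = 0 & mu [set: 'I_n] = 1].

Definition sorting_perms (U : Type) (le : rel U) (n : nat)
    (X : 'I_n -> U) : {set 'S_n} :=
  [set s : 'S_n | sorted le [seq X (s i) | i <- enum 'I_n]].

(* Positions [k] below are 1-based, as in sigma(1), ..., sigma(n), whereas
   ordinals are 0-based: the paper's sigma(k) is [s i] with [k = i.+1].
   [sorted_entry] is x_sigma(k), and it is [zero] at [k = 0]. *)
Definition sorted_entry (U : Type) (zero : U) (n : nat) (X : 'I_n -> U)
    (s : 'S_n) (k : nat) : U :=
  if k is j.+1 then oapp (fun i : 'I_n => X (s i)) zero (insub j) else zero.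

(* {sigma(k), ..., sigma(n)}, which is empty at [k = n.+1]. *)
Definition upper_set (n : nat) (s : 'S_n) (k : nat) : {set 'I_n} :=
  [set s i | i : 'I_n & (k <= i.+1)%N].

Definition C_term (R : realType) (U : Type) (zero : U)
    (L : U -> U -> R -> R -> U) (n : nat) (X : 'I_n -> U)
    (mu : {set 'I_n} -> R) (s : 'S_n) (k : nat) : U :=
  L (sorted_entry zero X s k) (sorted_entry zero X s k.-1)
    (mu (upper_set s k)) (mu (upper_set s k.+1)).

(* [oplus] need not have a neutral element, so the last term is the base of the
   iteration: t_1 + (t_2 + ... + (t_(n-1) + t_n)).  Meaningful for [0 < n]. *)
Definition C_operator (R : realType) (U : Type) (oplus : U -> U -> U) (zero : U)
    (L : U -> U -> R -> R -> U) (n : nat) (X : 'I_n -> U)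
    (mu : {set 'I_n} -> R) (s : 'S_n) : U :=
  \big[oplus/C_term zero L X mu s n]_(1 <= k < n) C_term zero L X mu s k.

Definition C_well_defined (R : realType) (U : Type) (le : rel U)
    (oplus : U -> U -> U) (K : set U) (zero : U)
    (L : U -> U -> R -> R -> U) (n : nat) : Prop :=
  forall (X : 'I_n -> U) (mu : {set 'I_n} -> R),
    (forall i, K (X i)) -> capacity mu ->
    {in sorting_perms le X &, forall s t : 'S_n,
       C_operator oplus zero L X mu s = C_operator oplus zero L X mu t}.

(* Main.v *)
(* Two permutations sorting X are joined by a chain of sorting permutations in
   which neighbours differ by swapping two adjacent positions carrying equal
   entries.  Such a swap, at positions k and k+1, changes only the set
   B_sigma(k+1), hence only two summands; by cancellation the operator is
   unchanged iff L(x, y, b1, c) + L(x, x, c, b2) takes the same value at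
   c = mu(B_sigma(k+1)) before and after the swap, where b1 = mu(B_sigma(k)) and
   b2 = mu(B_sigma(k+2)).  Every c, c' in [b2, b1] arise this way, and the only
   constraints on the other data are y = 0 and b1 = 1 when k = 1, and b2 = 0
   when k = n-1.  For n >= 4 the position k = 2 is unconstrained. *)
Require Import Defs.
From mathcomp Require Import all_boot all_order all_algebra all_fingroup.
From mathcomp Require Import classical_sets reals.
From mathcomp Require Import zify.

Import Order.TTheory GRing.Theory Num.Theory.
Local Open Scope ring_scope.

(** * Permutations that sort the same tuple *)

(** Strict growth gives [i <= u i] everywhere, while both sides have the same sum over all [i]; so
    every one of these inequalities is an equality. *)
Lemma perm_increasing_eq1 (n : nat) (u : 'S_n) :
  (forall i j : 'I_n, j = i.+1 :> nat -> (u i < u j)%N) -> u = 1%g.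
Proof.
move=> u_incr.
have le_u (i : 'I_n) : (i <= u i)%N.
  case: i => k; elim: k => [|k IHk] ltkn //=.
  have ltk : (k < n)%N by apply: ltnW.
  exact: leq_ltn_trans (IHk ltk) (u_incr (Ordinal ltk) (Ordinal ltkn) erefl).
have sum_u : (\sum_(i < n) i = \sum_(i < n) u i)%N.
  by rewrite (reindex_inj (@perm_inj _ u)).
have [_] := leqif_sum (fun (i : 'I_n) (_ : true) => leqif_eq (le_u i)).
rewrite sum_u eqxx => /esym/forallP eq_u.
by apply/permP => i; rewrite perm1; apply/esym/val_inj/eqP/eq_u.
Qed.

Lemma sorting_permsP (U : Type) (le : rel U) (n : nat) (X : 'I_n -> U)
    (s : 'S_n) : transitive le -> reflexive le ->
  reflect (forall i j : 'I_n, (i <= j)%N -> le (X (s i)) (X (s j)))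
          (s \in sorting_perms le X).
Proof.
move=> le_trans le_refl; rewrite inE; apply: (iffP idP).
  move=> Xs_sorted i j leij; have := sorted_leq_nth le_trans le_refl (X (s i)) Xs_sorted.
  move=> /(_ i j); rewrite !inE size_map size_enum_ord !ltn_ord.
  move=> /(_ isT isT leij).
  by rewrite !(nth_map i _ (fun k => X (s k))) ?size_enum_ord // !nth_ord_enum.
move=> le_Xs; rewrite sorted_map.
have : sorted ltn (map val (enum 'I_n)) by rewrite val_enum_ord iota_ltn_sorted.
rewrite sorted_map; apply: sub_sorted => i j /= /ltnW; exact: le_Xs.
Qed.

Lemma sorting_perms_tperm (U : Type) (le : rel U) (n : nat) (X : 'I_n -> U)
    (s : 'S_n) (i j : 'I_n) : X (s i) = X (s j) ->
  ((tperm i j * s)%g \in sorting_perms le X) = (s \in sorting_perms le X).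
Proof.
move=> eqX; rewrite !inE; congr sorted; apply: eq_map => k.
by rewrite permM; case: tpermP => [->|->|].
Qed.

(* The weight [\sum_i i * (s t^-1) i] grows each time an adjacent descent of
   [s t^-1] is removed, and the entries of [X] at such a descent are equal
   because both [s] and [t] sort [X]. *)
Lemma sorting_perms_invariant (U T : Type) (le : rel U) (n : nat)
    (X : 'I_n -> U) (f : 'S_n -> T) :
  antisymmetric le -> transitive le -> reflexive le ->
  (forall (s : 'S_n) (i j : 'I_n), s \in sorting_perms le X ->
     j = i.+1 :> nat -> X (s i) = X (s j) -> f (tperm i j * s)%g = f s) ->
  {in sorting_perms le X &, forall s t, f s = f t}.
Proof.
move=> le_anti le_trans le_refl f_swap s t s_sort t_sort.
pose w (s : 'S_n) := (\sum_(i < n) i * (s * t^-1)%g i)%N.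
have w_le s' : (w s' <= \sum_(i < n) n * n)%N.
  by apply: leq_sum => i _; apply: leq_mul; apply: ltnW.
have [m] := ubnP ((\sum_(i < n) n * n) - w s)%N.
elim: m s s_sort => // m IHm s s_sort w_ltm.
(* [(s * t^-1)%g l] is the position at which [t] lists [s l], so a descent is an adjacent pair of
   [s] that [t] lists in the opposite order. *)
have [/existsP[i /existsP[j /andP[/eqP def_j u_ji]]]|no_descent] :=
  boolP [exists i : 'I_n, exists j : 'I_n,
    (j == i.+1 :> nat) && ((s * t^-1)%g j < (s * t^-1)%g i)%N].
- have eqX : X (s i) = X (s j).
    apply: le_anti; apply/andP; split.
      have /sorting_permsP le_Xs := s_sort.
      by apply: le_Xs => //; rewrite def_j.
    have /sorting_permsP le_Xt := t_sort.
    by have := le_Xt le_trans le_refl _ _ (ltnW u_ji); rewrite !permM !permKV.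
  have neq_ij : j != i by rewrite -val_eqE /= def_j; lia.
  have w_swap : (w s < w (tperm i j * s)%g)%N.
    rewrite /w (bigD1 i) //= (bigD1 j) //= [ltnRHS](bigD1 i) //=.
    rewrite [X in (_ < _ + X)%N](bigD1 j) //=.
    rewrite -mulgA ![(tperm i j * _)%g _]permM tpermL tpermR.
    rewrite [X in (_ < _ + (_ + X))%N](eq_bigr (fun k : 'I_n => k * (s * t^-1)%g k)%N).
      rewrite def_j !mulSn.
      move: (nat_of_ord i) (nat_of_ord ((s * t^-1)%g i))
        (nat_of_ord ((s * t^-1)%g j)) (bigop _ _ _) u_ji.
      by clear; lia.
    by move=> k /andP[ki kj]; rewrite permM tpermD // eq_sym.
  rewrite -(f_swap s i j s_sort def_j eqX); apply: IHm.
    by rewrite sorting_perms_tperm.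
  by have := w_le (tperm i j * s)%g; lia.
(* Without adjacent descents [s * t^-1] is increasing, which forces [s = t]. *)
- have u1 : (s * t^-1)%g = 1%g.
    apply: perm_increasing_eq1 => i j def_j.
    rewrite ltn_neqAle leqNgt; apply/andP; split.
      by rewrite val_eqE (inj_eq perm_inj) -val_eqE /= def_j; lia.
    apply: contra no_descent => u_ji.
    apply/existsP; exists i; apply/existsP; exists j.
    by rewrite def_j eqxx.
  by rewrite -[s](mulgKV t) u1 mul1g.
Qed.

(** * Effect of an adjacent swap on the iterated sum *)

Lemma big_exchange_adjacent (U : Type) (oplus : U -> U -> U) (n k : nat)
    (F G : nat -> U) : commutative oplus -> associative oplus ->
  cancellation_law oplus -> (0 < k < n)%N ->
  (forall l, l != k -> l != k.+1 -> F l = G l) ->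
  \big[oplus/F n]_(1 <= l < n) F l = \big[oplus/G n]_(1 <= l < n) G l <->
  oplus (F k) (F k.+1) = oplus (G k) (G k.+1).
Proof.
move=> oplusC oplusA cancel /andP[k_gt0 ltkn] eqFG.
have cancelr x y z : oplus x z = oplus y z <-> x = y.
  by split=> [/cancel|->].
have cancel_big (r : seq nat) x y :
    \big[oplus/x]_(l <- r) F l = \big[oplus/y]_(l <- r) F l <-> x = y.
  elim: r => [|l r IHr]; first by rewrite !big_nil.
  rewrite !big_cons; split=> [|->//].
  by rewrite ![oplus (F l) _]oplusC => /cancelr/IHr.
(* Taking the sum from [k] on as the base of the iteration lets [cancel_big] remove the common
   prefix. *)
have split_big (H : nat -> U) : \big[oplus/H n]_(1 <= l < n) H l =
    \big[oplus / \big[oplus/H n]_(k <= l < n) H l]_(1 <= l < k) H l.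
  rewrite -big_cat_nested /index_iota.
  have -> : iota k (n - k) = iota (1 + (k - 1)) (n - k) by congr iota; lia.
  by rewrite -iotaD; congr bigop; congr iota; lia.
rewrite !split_big -[X in _ = X](eq_big_nat _ _ (F1 := F)); last first.
  by move=> l /andP[_ ltlk]; apply: eqFG; lia.
rewrite cancel_big !(big_ltn ltkn).
(* If [n = k.+1], the second changed summand is itself the base; otherwise a common tail remains to
   be cancelled. *)
have [->|neq_kn] := eqVneq n k.+1; first by rewrite !big_geq.
have ltk1n : (k.+1 < n)%N by lia.
rewrite !(big_ltn ltk1n) !oplusA (eqFG n) ?cancelr; try lia.
by rewrite (eq_big_nat _ _ (F2 := G)) ?cancelr // => l /andP[ltl _]; apply: eqFG; lia.
Qed.

Lemma sorted_entryE (U : Type) (zero : U) (n : nat) (X : 'I_n -> U) (s : 'S_n)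
    (i : 'I_n) : sorted_entry zero X s i.+1 = X (s i).
Proof. by rewrite /= insubT //= => lti; congr (X (s _)); apply: val_inj. Qed.

Lemma mem_upper_set (n : nat) (s : 'S_n) (k : nat) (i : 'I_n) :
  (s i \in upper_set s k) = (k <= i.+1)%N.
Proof. by rewrite mem_imset ?inE //; exact: perm_inj. Qed.

(** Only the tail that begins at the second swapped position, which is [i.+2] when counted from 1,
    separates the two. *)
Lemma upper_set_tperm (n : nat) (s : 'S_n) (i j : 'I_n) (k : nat) :
  j = i.+1 :> nat -> k != i.+2 ->
  upper_set (tperm i j * s)%g k = upper_set s k.
Proof.
move=> def_j neq_k; apply/setP => x.
rewrite -[x](permKV (tperm i j * s)%g) mem_upper_set permM mem_upper_set.
by case: tpermP => [->|->|//]; rewrite def_j; lia.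
Qed.

(** Since [i] counts from 0, [sorted_entry zero X s i] is the entry just before [X (s i)], or [zero]
    if [i] is 0. The tails at [i.+1], [i.+2] and [i.+3] begin at [s i], at [s j] and just after
    [s j]. *)
Lemma C_operator_tperm (R : realType) (U : Type) (oplus : U -> U -> U)
    (zero : U) (L : U -> U -> R -> R -> U) (n : nat) (X : 'I_n -> U)
    (mu : {set 'I_n} -> R) (s : 'S_n) (i j : 'I_n) :
  commutative oplus -> associative oplus -> cancellation_law oplus ->
  j = i.+1 :> nat -> X (s i) = X (s j) ->
  let f c := oplus (L (X (s i)) (sorted_entry zero X s i) (mu (upper_set s i.+1)) c)
                   (L (X (s i)) (X (s i)) c (mu (upper_set s i.+3))) in
  C_operator oplus zero L X mu (tperm i j * s)%g = C_operator oplus zero L X mu s <->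
  f (mu (upper_set (tperm i j * s)%g i.+2)) = f (mu (upper_set s i.+2)).
Proof.
move=> oplusC oplusA cancel def_j eqX f.
have entry_tperm k : sorted_entry zero X (tperm i j * s)%g k = sorted_entry zero X s k.
  case: k => //= k; case: insubP => //= l _ _.
  by rewrite permM; case: tpermP => [->|->|].
rewrite /C_operator (big_exchange_adjacent _ _ _ i.+1) //; last 2 first.
- by rewrite /= -def_j.
- by move=> l li lj; rewrite /C_term !entry_tperm !upper_set_tperm //; lia.
have entry_i : sorted_entry zero X s i.+1 = X (s i) by rewrite sorted_entryE.
have entry_j : sorted_entry zero X s i.+2 = X (s i).
  by rewrite -def_j sorted_entryE eqX.
rewrite /C_term !entry_tperm entry_i entry_j.
by rewrite (upper_set_tperm _ s i j i.+1) ?(upper_set_tperm _ s i j i.+3) //; lia.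
Qed.

(** * Realising prescribed values by a capacity *)

(** Let [A] be the set of positions after [j]. Sets containing [A] are weighed by which of [i], [j]
    they contain: [b2] for neither, [c] for [j] alone, [c'] for [i] alone, [b1] for both. The full
    set gets 1 and sets not containing [A] get 0. The last two hypotheses settle the overlaps with
    the full set and the empty set. *)
Lemma adjacent_tie_capacity (R : realType) (n : nat) (i j : 'I_n) (b1 b2 c c' : R) :
  j = i.+1 :> nat -> 0 <= b2 -> b1 <= 1 -> c \in `[b2, b1] -> c' \in `[b2, b1] ->
  (i = 0%N :> nat -> b1 = 1) -> (n = i.+2 -> b2 = 0) ->
  exists mu : {set 'I_n} -> R,
    [/\ capacity mu, mu (upper_set 1%g i.+1) = b1, mu (upper_set 1%g i.+2) = c,
        mu (upper_set (tperm i j) i.+2) = c' & mu (upper_set 1%g i.+3) = b2].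
Proof.
move=> def_j b2_ge0 b1_le1; rewrite !in_itv /= => /andP[cb2 cb1] /andP[c'b2 c'b1].
move=> b1_1 b2_0; pose A := upper_set (1%g : 'S_n) i.+3.
pose g (p q : bool) : R := if p then (if q then b1 else c') else (if q then c else b2).
pose mu (C : {set 'I_n}) : R :=
  if C == [set: 'I_n] then 1 else if A \subset C then g (i \in C) (j \in C) else 0.
have g_ge p q : b2 <= g p q by case: p q => [] [] //=; exact: le_trans cb1.
have g_le p q : g p q <= b1 by case: p q => [] [] //=; exact: le_trans cb1.
have g_mono (p p' q q' : bool) : (p -> p') -> (q -> q') -> g p q <= g p' q'.
  case: p p' q q' => [] [] [] [] hp hq; rewrite /g ?lexx //;
    do ?[by have := hp isT|by have := hq isT].
  exact: le_trans cb1.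
have g_le1 p q : g p q <= 1 by exact: le_trans b1_le1.
have g_ge0 p q : 0 <= g p q by exact: le_trans (g_ge p q).
have mem_up k (x : 'I_n) : (x \in upper_set 1%g k) = (k <= x.+1)%N.
  by rewrite -[x in LHS]perm1 mem_upper_set.
have Aup k : (k <= i.+3)%N -> A \subset upper_set 1%g k.
  by move=> lek; apply/fintype.subsetP => x; rewrite !mem_up; lia.
have mu_g (C : {set 'I_n}) : A \subset C ->
    (C = [set: 'I_n] -> i = 0%N :> nat) -> mu C = g (i \in C) (j \in C).
  move=> subAC Ci; rewrite /mu subAC; case: eqP => // C_T.
  by rewrite C_T !inE /= b1_1 //; exact: Ci.
have i0_up k : (i < k <= i.+3)%N ->
    upper_set (1%g : 'S_n) k = [set: 'I_n] -> i = 0%N :> nat.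
  move=> ltk up_k.
  have : Ordinal (leq_ltn_trans (leq0n i) (ltn_ord i)) \in upper_set (1%g : 'S_n) k.
    by rewrite up_k inE.
  by rewrite mem_up /=; lia.
exists mu; split.
- split.
  + move=> C; rewrite in_itv /= /mu.
    by do 2?[case: ifP => _]; rewrite ?g_ge0 ?g_le1 ?lexx ?ler01.
  + move=> C D CD; rewrite /mu; case: (eqVneq D [set: 'I_n]) => [_|D_T].
      by do 2?[case: ifP => _]; rewrite ?g_le1 ?lexx ?ler01.
    have -> : (C == [set: 'I_n]) = false.
      by apply: contraNF D_T => /eqP C_T; rewrite -finset.subTset -C_T.
    case: ifP => subAC; last by case: ifP.
    rewrite (fintype.subset_trans subAC CD).
    by apply: g_mono; apply/fintype.subsetP.
  (* The empty set contains [A] only if nothing follows [j], and then [b2] is 0. *)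
  + rewrite /mu; case: eqP => [/setP /(_ i)|_]; first by rewrite !inE.
    rewrite finset.subset0 !inE /=; case: eqP => // A0; apply: b2_0.
    have [//|neq_n] := eqVneq n i.+2.
    have lti : (i.+2 < n)%N by have := ltn_ord j; lia.
    by have := mem_up i.+3 (Ordinal lti); rewrite -/A A0 inE ltnSn.
  + by rewrite /mu eqxx.
- rewrite mu_g; [|by apply: Aup; lia|by apply: i0_up; lia].
  by rewrite !mem_up def_j ltnSn leqW.
- rewrite mu_g; [|by apply: Aup; lia|by apply: i0_up; lia].
  by rewrite !mem_up def_j ltnn leqnn.
(* After the swap this tail is [A] together with [i]; it misses [j], so it is not the full set. *)
- have mem_up' (x : 'I_n) :
      (x \in upper_set (tperm i j) i.+2) = (x == i) || (i.+2 < x.+1)%N.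
    rewrite -[x in LHS](permKV (tperm i j)) mem_upper_set tpermV.
    case: tpermP => [->|->|/eqP + /eqP]; rewrite -!val_eqE /= ?def_j; lia.
  rewrite mu_g.
  + rewrite !mem_up' eqxx -val_eqE /= def_j ltnn orbF.
    by rewrite gtn_eqF.
  + by apply/fintype.subsetP => x; rewrite mem_up mem_up' => ->; rewrite orbT.
  + move=> /setP /(_ j); rewrite mem_up' inE -val_eqE /= def_j ltnn; lia.
- rewrite mu_g; [|by apply: Aup; lia|by apply: i0_up; lia].
  by rewrite !mem_up def_j ltnNge leqnSn /= ltnn.
Qed.

(** * Well-definedness for arbitrary [n], and the three cases *)

Lemma C_well_defined_adjacent_ties (R : realType) (U : Type)
    (oplus : U -> U -> U) (le : rel U) (K : set U) (zero : U)
    (L : U -> U -> R -> R -> U) (n : nat) :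
  commutative oplus -> associative oplus -> cancellation_law oplus ->
  antisymmetric le -> transitive le -> total le ->
  K zero -> (forall x, K x -> le zero x) ->
  C_well_defined le oplus K zero L n <->
  (forall (i : nat) (x y : U) (b1 b2 : R), (i.+1 < n)%N ->
     K x -> K y -> le y x -> b1 \in `[0, 1] -> b2 \in `[0, 1] -> b2 <= b1 ->
     (i = 0%N -> y = zero /\ b1 = 1) -> (n = i.+2 -> b2 = 0) ->
     constant_on `[b2, b1] (fun c : R => oplus (L x y b1 c) (L x x c b2))).
Proof.
move=> oplusC oplusA cancel le_anti le_trans le_total K0 le0.
have le_refl : reflexive le by move=> x; have := le_total x x; rewrite orbb.
split=> [wd i0 x y b1 b2 lti Kx Ky leyx b1I b2I b21|ties X mu KX].
- move=> at_first at_last c c' cI c'I; have lt_i : (i0 < n)%N by apply: ltnW.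
  pose i := Ordinal lt_i; pose j := Ordinal lti.
  have def_j : j = i.+1 :> nat by [].
  move: b1I b2I; rewrite !in_itv /= => /andP[b1_ge0 b1_le1] /andP[b2_ge0 b2_le1].
  have b1_1 : i = 0%N :> nat -> b1 = 1 by move=> /at_first[].
  have [mu [mu_cap mu1 muc muc' mu2]] :=
    @adjacent_tie_capacity R n i j b1 b2 c c' def_j b2_ge0 b1_le1 cI c'I b1_1 at_last.
  (* A step from [y] up to [x] at [i]: the identity sorts it, [i] and [j] tie, and the entry before
     them is [y]. For [i = 0] that entry is [zero], which [at_first] equates with [y]. *)
  pose X (l : 'I_n) := if (l < i)%N then y else x.
  have Xi : X i = x by rewrite /X ltnn.
  have Xij : X i = X j by rewrite Xi /X /= ltnNge leqnSn.
  have KX l : K (X l) by rewrite /X; case: ifP.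
  have X_sort : (1%g : 'S_n) \in sorting_perms le X.
    apply/sorting_permsP => // k l lekl; rewrite !perm1 /X.
    by case: ifP => ltk; case: ifP => // ltl; lia.
  have entry_i : sorted_entry zero X 1%g i = y.
    case def_i : (nat_of_ord i) => [|k] /=.
      by have [] := at_first def_i.
    have ltk : (k < n)%N by have := ltn_ord i; lia.
    by rewrite insubT /= perm1 /X def_i /= ltnSn.
  have := @C_operator_tperm R U oplus zero L n X mu 1%g i j oplusC oplusA cancel def_j.
  rewrite !perm1 mulg1 => /(_ Xij) /=[+ _].
  rewrite mu1 muc muc' mu2 Xi -[i0]/(nat_of_ord i) entry_i => H.
  apply/esym/H/wd => //.
  by rewrite -[tperm i j]mulg1 sorting_perms_tperm // !perm1.
- move=> [mu_itv mu_mono mu0 mu1].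
  apply: sorting_perms_invariant => // s i j s_sort def_j eqX.
  apply/C_operator_tperm => //=.
  have upper_mono k l : (k <= l)%N -> mu (upper_set s l) <= mu (upper_set s k).
    move=> lekl; apply: mu_mono; apply/fintype.subsetP => x.
    by rewrite -[x](permKV s) !mem_upper_set; apply: leq_trans.
  (* The swapped tail still lies between the two neighbouring tails, which the swap leaves
     unchanged. *)
  have swap_itv : mu (upper_set (tperm i j * s)%g i.+2) \in
      `[mu (upper_set s i.+3), mu (upper_set s i.+1)].
    rewrite in_itv /= -(@upper_set_tperm n s i j i.+3) //; last by lia.
    rewrite -(@upper_set_tperm n s i j i.+1) //; last by lia.
    rewrite !mu_mono //; apply/fintype.subsetP => x;
    by rewrite -[x](permKV (tperm i j * s)%g) !mem_upper_set; lia.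
  apply: (ties i) => //.
  + by rewrite -def_j.
  + case: (nat_of_ord i) => //= k; case: insubP => //= *; exact: KX.
  + case def_i : (nat_of_ord i) => [|k] /=; first exact: le0.
    have ltk : (k < n)%N by have := ltn_ord i; lia.
    rewrite insubT /=; have /sorting_permsP le_Xs := s_sort.
    by apply: le_Xs => //=; lia.
  + by apply: upper_mono; lia.
  + move=> i0; rewrite i0; split => //; rewrite -mu1; congr mu; apply/setP => x.
    by rewrite -[x](permKV s) mem_upper_set !inE.
  + move=> def_n; rewrite -mu0; congr mu; apply/setP => x.
    by rewrite -[x](permKV s) mem_upper_set inE; have := ltn_ord ((s^-1)%g x); lia.
  + by rewrite in_itv /= !upper_mono //; lia.
Qed.

Theorem theorem3p4 (R : realType) (d : Order.disp_t) (U : porderType d)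
    (oplus : U -> U -> U) (le : rel U) (K : set U) (zero one : U)
    (L : U -> U -> R -> R -> U)
    (oplusC : commutative oplus) (oplusA : associative oplus)
    (le_adm : admissible_order le)
    (Kzero : K zero) (Kone : K one)
    (zero_least : forall x : U, K x -> (zero <= x)%O)
    (one_greatest : forall x : U, K x -> (x <= one)%O)
    (zero_lt_one : (zero < one)%O)
    (L_K : forall (x y : U) (a b : R), K x -> K y ->
       a \in `[0, 1] -> b \in `[0, 1] -> K (L x y a b))
    (oplus_cancel : cancellation_law oplus) :
  [/\ C_well_defined le oplus K zero L 2 <->
      (forall x : U, K x ->
         constant_on `[0, 1]
           (fun c : R => oplus (L x zero 1 c) (L x x c 0))),
      C_well_defined le oplus K zero L 3 <->
      (forall (b : R) (x x1 x2 : U), b \in `[0, 1] ->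
         K x -> K x1 -> K x2 -> le x2 x1 ->
         constant_on `[b, 1]
           (fun c : R => oplus (L x zero 1 c) (L x x c b)) /\
         constant_on `[0, b]
           (fun c : R => oplus (L x1 x2 b c) (L x1 x1 c 0))) &
      forall n : nat, (4 <= n)%N ->
      (C_well_defined le oplus K zero L n <->
      (forall (x1 x2 : U) (b1 b2 : R), K x1 -> K x2 -> le x2 x1 ->
         b1 \in `[0, 1] -> b2 \in `[0, 1] -> b2 <= b1 ->
         constant_on `[b2, b1]
           (fun c : R => oplus (L x1 x2 b1 c) (L x1 x1 c b2))))].
Proof.
have [le_anti le_trans le_total le_ext] := le_adm.
have le0 x : K x -> le zero x by move=> /zero_least; apply: le_ext.
have I0 : (0 : R) \in `[0, 1] by rewrite in_itv /= lexx ler01.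
have I1 : (1 : R) \in `[0, 1] by rewrite in_itv /= lexx ler01.
have wdP n := @C_well_defined_adjacent_ties R U oplus le K zero L n oplusC oplusA
  oplus_cancel le_anti le_trans le_total Kzero le0.
split=> [||n n_ge4]; apply: (iff_trans (wdP _)).
(* For [n = 2] the only swap is both first and last, so [y], [b1] and [b2] are all forced. *)
- split=> [ties x Kx|tie [|//] x y b1 b2 _ Kx Ky _ _ _ _ /(_ erefl)[-> ->] /(_ erefl) ->].
    by apply: (ties 0%N) => //; exact: le0.
  exact: tie.
(* For [n = 3] the swap at [i = 0] yields the first function and the one at [i = 1] the second. *)
- split=> [ties b x x1 x2 bI Kx Kx1 Kx2 le21|tie [|[|//]] x y b1 b2 _ Kx Ky leyx b1I b2I _].
  + move: (bI); rewrite in_itv /= => /andP[b_ge0 b_le1]; split.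
      by apply: (ties 0%N) => //; exact: le0.
    exact: (ties 1%N).
  + by move=> /(_ erefl)[-> ->] _; have [] := tie b2 x x y b2I Kx Kx Ky leyx.
  + by move=> _ /(_ erefl) ->; have [] := tie b1 x x y b1I Kx Kx Ky leyx.
- split=> [ties x1 x2 b1 b2 Kx1 Kx2 le21 b1I b2I b21|tie i x y b1 b2 _ Kx Ky leyx b1I b2I b21 _ _].
    (* With [n >= 4] the swap at [i = 1] is neither first nor last, so both side conditions are
       vacuous. *)
    by apply: (ties 1%N) => //; lia.
  exact: tie.
Qed.
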